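(* Let $\alpha$ be a badly approximable irrational (i.e. $\inf_{n \in \mathbb{N}} n \| n \alpha \| >0$) and let $\beta \in \mathbb{R}$. For any integer $N \ge 1$, let $n_0=n_0(\alpha,\beta,N) \in [1,N]$ be an integer with $\| n_0 \alpha + \beta \| = \min_{1 \le n \le N} \| n \alpha + \beta \|$. Then \[ \sum_{\substack{n=1 \\ n \neq n_0}}^N \frac{1}{\| n \alpha + \beta \|} = 2N \log N + O(N \log \log N) \] with an implied constant depending only on $\alpha$. If in addition $\inf_{n \in \mathbb{N}} (n \log \log n) \| n \alpha + \beta \| >0$, then for all $N \ge 1$, \[ \sum_{n=1}^N \frac{1}{\| n \alpha + \beta \|} = 2N \log N + O(N \log \log N), \qquad \sum_{n=1}^N \frac{1}{n \| n \alpha + \beta \|} = (\log N)^2 + O(\log N \log \log N) \] with implied constants depending only on $\alpha$ and $\beta$.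
   Context: $\| x \|$ denotes the distance from $x$ to the nearest integer. In error terms and in the hypothesis, $\log x$ means $\log \max\{e,x\}$. *)

(* Defs.v *)
From mathcomp Require Import all_boot all_order all_algebra.
From mathcomp Require Import all_classical all_reals all_analysis.

Set Implicit Arguments.
Unset Strict Implicit.
Unset Printing Implicit Defensive.

Import Order.TTheory GRing.Theory Num.Theory.

Local Open Scope classical_set_scope.
Local Open Scope ring_scope.

Definition nint_dist (R : realType) (x : R) : R :=
  inf [set `|x - m%:~R| | m in [set: int]].

Definition badly_approximable (R : realType) (alpha : R) : Prop :=
  0 < inf [set n%:R * nint_dist (n%:R * alpha) | n in [set n : nat | (0 < n)%N]].

(* Truncated logarithm: always at least 1, so that [tlog (tlog x)] is a
   positive error scale for every x. *)
Definition tlog (R : realType) (x : R) : R := ln (Num.max (expR 1) x).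

(* Main.v *)
(* For a reduced fraction p/q with |q alpha - p| <= 1/q, the points i alpha + beta,
   i < q, lie mod 1 within 2/q of the points j/q, each used once.  Hence sums of
   h_tau(t) = 1 / max(tau, t) over such a block equal q times the integral of
   h_tau over a period up to O(1/tau).  When alpha is badly approximable,
   Dirichlet's theorem gives such a q in [cQ, Q] for every Q, so [1, N] splits
   into O(log N) blocks, and tau = log N / N gives 2 N log N + O(N log log N).
   All points but the nearest satisfy ||n alpha + beta|| >= c / (2N); undoing the
   truncation costs at most the sum of h_{c/2N} - h_tau over a single block of
   length q between N and O(N), which is O(N log log N).  The weighted sum
   follows by Abel summation. *)
Require Import Defs.
From mathcomp Require Import all_boot all_order all_algebra.
From mathcomp Require Import all_classical all_reals all_analysis.
From mathcomp Require Import ring lra zify.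

Set Implicit Arguments.
Unset Strict Implicit.
Unset Printing Implicit Defensive.

Import Order.TTheory GRing.Theory Num.Theory.

Local Open Scope classical_set_scope.
Local Open Scope ring_scope.

(** * Distance to the nearest integer and Dirichlet approximation *)

Section NearestInteger.
Variable R : realType.
Implicit Types (x y alpha beta : R) (m p : int).

Lemma nint_dist_le x m : nint_dist x <= `|x - m%:~R|.
Proof.
apply: ge_inf; last by exists m.
by exists 0 => _ [k _ <-].
Qed.

Lemma le_nint_dist x d : (forall m, d <= `|x - m%:~R|) -> d <= nint_dist x.
Proof.
move=> le_d; apply: lb_le_inf; first by exists `|x - 0%:~R|, 0.
by move=> _ [m _ <-].
Qed.

Lemma nint_dist_ge0 x : 0 <= nint_dist x.
Proof. exact: le_nint_dist. Qed.

Lemma nint_dist_le_half x : nint_dist x <= 2^-1.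
Proof.
have /andP[lo hi] := floor_itv x; rewrite intrD in hi.
have [h|h] := lerP (x - (Num.floor x)%:~R) 2^-1.
  by apply: le_trans (nint_dist_le x (Num.floor x)) _; rewrite ger0_norm; lra.
apply: le_trans (nint_dist_le x (Num.floor x + 1)) _.
by rewrite intrD ler0_norm; lra.
Qed.

(** The free integer [m] allows two points to be compared modulo 1. *)
Lemma nint_dist_lipschitz x y m :
  nint_dist x <= nint_dist y + `|x - y - m%:~R|.
Proof.
rewrite -lerBlDr; apply: le_nint_dist => k; rewrite lerBlDr.
apply: le_trans (nint_dist_le x (k + m)) _.
have -> : x - (k + m)%:~R = (y - k%:~R) + (x - y - m%:~R).
  by rewrite intrD; ring.
exact: ler_normD.
Qed.

Lemma nint_distN x : nint_dist (- x) = nint_dist x.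
Proof.
suff le_N y : nint_dist (- y) <= nint_dist y.
  by apply/le_anti; rewrite le_N -{1}(opprK x) le_N.
apply: le_nint_dist => m; apply: le_trans (nint_dist_le _ (- m)) _.
by rewrite intrN opprK addrC distrC.
Qed.

Lemma nint_distD x y : nint_dist (x + y) <= nint_dist x + nint_dist y.
Proof.
rewrite -lerBlDl; apply: le_nint_dist => m; rewrite lerBlDl.
by apply: le_trans (nint_dist_lipschitz _ x m) _; rewrite [x + y]addrC addrK.
Qed.

Lemma nint_dist_frac (j q : nat) : (0 < q)%N -> (j <= q)%N ->
  nint_dist (j%:R / q%:R : R) = (minn j (q - j))%:R / q%:R.
Proof.
move=> q0 jq; have q0R : 0 < q%:R :> R by rewrite ltr0n.
have minl : (minn j (q - j))%:R <= j%:R :> R by rewrite ler_nat geq_minl.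
have minr : (minn j (q - j))%:R <= q%:R - j%:R :> R.
  by rewrite -natrB // ler_nat geq_minr.
have jqR : j%:R <= q%:R :> R by rewrite ler_nat.
apply/le_anti/andP; split.
  case: leqP => _.
    apply: le_trans (nint_dist_le _ 0) _.
    by rewrite subr0 ger0_norm // divr_ge0.
  apply: le_trans (nint_dist_le _ 1) _.
  rewrite distrC ger0_norm ?subr_ge0 ?ler_pdivrMr ?mul1r //.
  by rewrite ler_pdivlMr // mulrBl divfK ?gt_eqF // mul1r natrB.
apply: le_nint_dist => m; rewrite ler_pdivrMr //.
rewrite -{2}(gtr0_norm q0R) -normrM mulrBl divfK ?gt_eqF // lter_normr.
apply/orP; have [m0|m0] := lerP m 0.
  left; have : m%:~R <= 0 :> R by rewrite -(ler_int R) in m0.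
  nra.
right; have : 1 <= m%:~R :> R by rewrite (ler_int _ 1 m) -gtz0_ge1.
nra.
Qed.

Lemma badly_approximableP alpha : badly_approximable alpha ->
  exists c : R, [/\ 0 < c, c <= 2^-1 &
    forall n : nat, (0 < n)%N -> c <= n%:R * nint_dist (n%:R * alpha)].
Proof.
rewrite /badly_approximable; set c := inf _ => c0; exists c.
have le_c n : (0 < n)%N -> c <= n%:R * nint_dist (n%:R * alpha).
  move=> n0; apply: ge_inf; last by exists n.
  by exists 0 => _ [k _ <-]; rewrite mulr_ge0 ?nint_dist_ge0.
(* The bound c <= 1/2 is the case n = 1, as ||alpha|| <= 1/2. *)
split=> //; apply: le_trans (le_c 1%N isT) _.
by rewrite !mul1r nint_dist_le_half.
Qed.

(** Pigeonhole: of the Q + 1 fractional parts of n alpha, 0 <= n <= Q, two share one of Q bins of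
    width 1/Q. Coprimality is asked because multiplication by p will have to permute the residues
    mod q. *)
Lemma dirichlet_approximation alpha (Q : nat) : (0 < Q)%N ->
  exists (q : nat) p, [/\ (0 < q <= Q)%N, coprimez p q &
    `|q%:R * alpha - p%:~R| <= Q%:R^-1].
Proof.
move=> Q0; have Q0R : 0 < Q%:R :> R by rewrite ltr0n.
(* Lowest terms come for free: dividing p and q by their gcd increases neither q nor the error. *)
suff [q [p [/andP[q0 qQ] qp]]] : exists (q : nat) p,
    (0 < q <= Q)%N /\ `|q%:R * alpha - p%:~R| <= Q%:R^-1.
  have g0 : (0 < gcdn `|p| q)%N by rewrite gcdn_gt0 q0 orbT.
  have [p' pE] : exists p', p = p' * (gcdn `|p| q)%:Z.
    by apply/dvdzP; rewrite dvdzE absz_nat dvdn_gcdl.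
  have /dvdnP[q' qE] := dvdn_gcdr `|p| q.
  set g := gcdn `|p| q in g0 pE qE.
  have q'0 : (0 < q')%N by move: q0; rewrite qE muln_gt0 => /andP[].
  exists q', p'; split.
  - by rewrite q'0 (leq_trans _ qQ) // qE leq_pmulr.
  - rewrite /coprimez /gcdz /=; apply/eqP; congr Posz.
    apply/eqP; rewrite -(eqn_pmul2r g0) mul1n muln_gcdl.
    have <- : `|p|%N = (`|p'| * g)%N by rewrite [in LHS]pE abszM.
    by rewrite -qE.
  - apply: le_trans qp.
    have -> : q%:R * alpha - p%:~R = (q'%:R * alpha - p'%:~R) * g%:R.
      by rewrite [in LHS]qE [in LHS]pE natrM intrM -pmulrn; ring.
    rewrite normrM normr_nat.
    by rewrite ler_peMr // ler1n.
pose frac n := n%:R * alpha - (Num.floor (n%:R * alpha))%:~R.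
have frac_itv n : 0 <= frac n < 1.
  have := floor_itv (n%:R * alpha); rewrite intrD /frac.
  by move=> /andP[lo hi]; apply/andP; split; lra.
pose bin n := `|Num.floor (Q%:R * frac n)|%N.
have binE n : ((bin n)%:R : R) <= Q%:R * frac n < (bin n)%:R + 1.
  have /andP[f0 f1] := frac_itv n.
  have b0 : 0 <= Num.floor (Q%:R * frac n) by rewrite floor_ge0 mulr_ge0.
  have := floor_itv (Q%:R * frac n); rewrite intrD.
  by rewrite -{1 2}(gez0_abs b0).
have bin_lt n : (bin n < Q)%N.
  have /andP[f0 f1] := frac_itv n; have /andP[lo _] := binE n.
  by rewrite -(ltr_nat R); nra.
have [i [j [ij jQ eq_bin]]] :
    exists i j : nat, [/\ (i < j)%N, (j <= Q)%N & bin i = bin j].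
  have : ~~ injectiveb (fun i : 'I_Q.+1 => Ordinal (bin_lt i)).
    apply/injectiveP => /leq_card; rewrite !card_ord.
    by rewrite ltnn.
  case/injectivePn => i [j neq_ij [eq_bin]].
  have [lt_ij|lt_ji|eq_ij] := ltngtP i j.
  - by exists i, j; rewrite lt_ij -ltnS ltn_ord.
  - by exists j, i; rewrite lt_ji -ltnS ltn_ord.
  - by move/eqP: neq_ij; case; apply: val_inj.
exists (j - i)%N, (Num.floor (j%:R * alpha) - Num.floor (i%:R * alpha)).
split; first by rewrite subn_gt0 ij (leq_trans (leq_subr _ _)).
have -> : (j - i)%:R * alpha -
    (Num.floor (j%:R * alpha) - Num.floor (i%:R * alpha))%:~R =
    frac j - frac i.
  by rewrite /frac natrB 1?ltnW // intrB; ring.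
have := binE i; have := binE j; rewrite eq_bin => /andP[jl jh] /andP[il ih].
rewrite -(ler_pM2l Q0R) mulfV ?gt_eqF // -{1}(gtr0_norm Q0R) -normrM ler_norml.
by apply/andP; split; lra.
Qed.

End NearestInteger.

Lemma ln_le_subr1 (R : realType) (x : R) : 0 < x -> ln x <= x - 1.
Proof. by move=> x0; rewrite -{1}(subrKC 1 x) le_ln1Dx; lra. Qed.

(** * The truncated inverse and its Riemann sums *)

Section TruncatedInverse.
Variables (R : realType) (tau : R).
Hypothesis tau0 : 0 < tau.
Implicit Types x a b : R.

(** Bounded by 1/tau also at negative arguments, which arise when 2/q is subtracted from a
    distance. *)
Definition trunc_inv x : R := (Num.max tau x)^-1.

(** The antiderivative of [trunc_inv] vanishing at 0, linear on the negative axis too. Twice its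
    value at 1/2 is the integral of h_tau(||t||) over a period. *)
Definition trunc_inv_prim x : R :=
  if x <= tau then x / tau else 1 + ln (x / tau).

Lemma trunc_inv_gt0 x : 0 < trunc_inv x.
Proof. by rewrite invr_gt0 lt_max tau0. Qed.

Lemma trunc_inv_le x : trunc_inv x <= tau^-1.
Proof. by rewrite lef_pV2 ?posrE ?lt_max ?tau0 // le_max lexx. Qed.

Lemma trunc_invE x : tau <= x -> trunc_inv x = x^-1.
Proof. by move=> h; rewrite /trunc_inv max_r. Qed.

Lemma le_trunc_inv a b : a <= b -> trunc_inv b <= trunc_inv a.
Proof.
move=> ab; rewrite lef_pV2 ?posrE ?lt_max ?tau0 //.
by rewrite ge_max !le_max lexx ab orbT.
Qed.

(** Mean value bounds for a nonincreasing derivative. On the logarithmic part they are ln y <= y - 1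
    at y = b/a and at y = a/b, so no integration is involved. *)
Lemma trunc_inv_prim_bounds a b : a <= b ->
  (b - a) * trunc_inv b <= trunc_inv_prim b - trunc_inv_prim a
    <= (b - a) * trunc_inv a.
Proof.
move=> ab; rewrite /trunc_inv_prim /trunc_inv.
have ln_div_le (u v : R) : 0 < u -> 0 < v -> ln (u / v) <= (u - v) / v.
  move=> u0 v0. apply: le_trans (ln_le_subr1 (divr_gt0 u0 v0)) _.
  by rewrite mulrBl divff ?gt_eqF.
have ln_divN (u v : R) : 0 < u -> 0 < v -> ln (u / v) = - ln (v / u).
  by move=> u0 v0; rewrite -lnV ?posrE ?divr_gt0 // invf_div.
have inv_tau : tau * tau^-1 = 1 by rewrite divff ?gt_eqF.
have [bt|bt] := lerP b tau.
  by rewrite (le_trans ab bt) (max_l (le_trans ab bt)) -mulrBl lexx.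
have b0 : 0 < b := lt_trans tau0 bt.
have lnb := ln_div_le _ _ b0 tau0.
have lnb' := ln_div_le _ _ tau0 b0; rewrite ln_divN // in lnb'.
have tb : tau^-1 >= b^-1 by rewrite lef_pV2 // ltW.
have [at_|at_] := lerP a tau.
  rewrite !mulrBl divff ?gt_eqF // in lnb'; rewrite mulrBl inv_tau in lnb.
  have ib : b * b^-1 = 1 by rewrite divff ?gt_eqF.
  (* An interval straddling tau is cut there; the linear piece has slope 1/tau >= 1/b. *)
  have hb : tau / b - a / b <= 1 - a / tau.
    by rewrite -mulrBl -inv_tau -mulrBl ler_wpM2l ?subr_ge0.
  by apply/andP; split; rewrite !mulrBl ?ib; lra.
have a0 : 0 < a := lt_trans tau0 at_.
have -> : 1 + ln (b / tau) - (1 + ln (a / tau)) = ln (b / a).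
  by rewrite !ln_div ?posrE //; ring.
rewrite ln_div_le // andbT ln_divN //.
have := ln_div_le _ _ a0 b0; rewrite !mulrBl; lra.
Qed.

Lemma le_trunc_inv_prim a b : a <= b -> trunc_inv_prim a <= trunc_inv_prim b.
Proof.
move=> ab; have /andP[+ _] := trunc_inv_prim_bounds ab.
move=> h; rewrite -subr_ge0; apply: le_trans h.
by rewrite mulr_ge0 ?subr_ge0 // ltW ?trunc_inv_gt0.
Qed.

Lemma trunc_inv_prim_le x : 0 <= x -> trunc_inv_prim x <= x / tau.
Proof.
move=> x0; have /andP[_] := trunc_inv_prim_bounds x0.
by rewrite /trunc_inv_prim /trunc_inv (ltW tau0) (max_l (ltW tau0)) mul0r !subr0.
Qed.

Lemma trunc_inv_prim_large x : tau <= x ->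
  trunc_inv_prim x = 1 + ln x - ln tau.
Proof.
move=> tx; have x0 := lt_le_trans tau0 tx.
rewrite /trunc_inv_prim; case: ifP => [xt|_]; last first.
  by rewrite ln_div ?posrE //; ring.
have -> : x = tau by apply/le_anti; rewrite xt.
by rewrite divff ?gt_eqF //; ring.
Qed.

(* The parts j < q - q./2 and j >= q - q./2 of the sum telescope separately. *)
Lemma sum_minn_split (q : nat) (f : nat -> R) :
  \sum_(j < q) f (minn j (q - j)) =
  \sum_(0 <= k < q - q./2) f k + \sum_(0 <= k < q./2) f k.+1.
Proof.
have half_le : (q./2 <= q)%N by lia.
rewrite -(big_mkord xpredT (fun j => f (minn j (q - j)))).
rewrite (@big_cat_nat _ _ _ (q - q./2)) ?leq_subr //=; congr (_ + _).
  apply: eq_big_nat => j /andP[_ jq].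
  by congr f; lia.
rewrite -{1}(add0n (q - q./2)%N) big_addn subKn // big_nat_rev /=.
by apply: eq_big_nat => j /andP[_ jq]; congr f; lia.
Qed.

(** Each summand lies between q times the integrals of [trunc_inv] over the intervals of length 1/q
    to its right and to its left; these telescope. *)
Lemma sum_trunc_inv_shift (q n : nat) (s : R) : (0 < q)%N ->
  q%:R * (trunc_inv_prim ((n%:R - s) / q%:R) - trunc_inv_prim (- s / q%:R))
  <= \sum_(0 <= k < n) trunc_inv ((k%:R - s) / q%:R)
  <= q%:R * (trunc_inv_prim ((n%:R - s - 1) / q%:R)
             - trunc_inv_prim ((- s - 1) / q%:R)).
Proof.
move=> q0; have q0R : 0 < q%:R :> R by rewrite ltr0n.
have step x : trunc_inv_prim ((x + 1) / q%:R) - trunc_inv_prim (x / q%:R)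
    <= q%:R^-1 * trunc_inv (x / q%:R) /\
    q%:R^-1 * trunc_inv ((x + 1) / q%:R) <=
    trunc_inv_prim ((x + 1) / q%:R) - trunc_inv_prim (x / q%:R).
  have ab : (x + 1) / q%:R - x / q%:R = q%:R^-1 by ring.
  have /trunc_inv_prim_bounds/andP[] : x / q%:R <= (x + 1) / q%:R.
    by rewrite -subr_ge0 ab invr_ge0 ltW.
  by rewrite ab.
pose u t k := trunc_inv_prim ((k%:R - t) / q%:R).
have tele t : \sum_(0 <= k < n) (u t k.+1 - u t k) = u t n - u t 0%N.
  by rewrite telescope_sumr.
have shift (y : R) k : k.+1%:R - y = k%:R - y + 1 by rewrite -natr1; ring.
apply/andP; split.
- have <- : u s n - u s 0%N = trunc_inv_prim ((n%:R - s) / q%:R)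
      - trunc_inv_prim (- s / q%:R) by rewrite /u sub0r.
  rewrite -tele mulr_sumr ler_sum // => k _.
  by rewrite /u shift -ler_pdivlMl //; case: (step (k%:R - s)).
- have <- : u (s + 1) n - u (s + 1) 0%N =
      trunc_inv_prim ((n%:R - s - 1) / q%:R)
      - trunc_inv_prim ((- s - 1) / q%:R) by rewrite /u sub0r !opprD addrA.
  rewrite -tele mulr_sumr ler_sum // => k _.
  have -> : k%:R - s = k%:R - (s + 1) + 1 by ring.
  by rewrite /u shift -ler_pdivrMl //; case: (step (k%:R - (s + 1))).
Qed.

(** With shifts 2 and 1 the integrals bounding the two halves start at -3/q and -2/q; the stretches
    below 0, where the integrand is 1/tau, contribute 3/tau + 2/tau. *)
Lemma sum_trunc_inv_le (q : nat) : (0 < q)%N ->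
  \sum_(j < q) trunc_inv (((minn j (q - j))%:R - 2) / q%:R)
    <= 2 * q%:R * trunc_inv_prim 2^-1 + 5 / tau.
Proof.
move=> q0; have q0R : 0 < q%:R :> R by rewrite ltr0n.
rewrite (sum_minn_split _ (fun k => trunc_inv ((k%:R - 2) / q%:R))).
have /andP[_ le1] := sum_trunc_inv_shift (q - q./2) 2 q0.
have /andP[_ le2] := sum_trunc_inv_shift q./2 1 q0.
under [X in _ + X]eq_bigr => k _.
  have -> : k.+1%:R - 2 = k%:R - 1 :> R by rewrite -natr1; ring.
  over.
apply: le_trans (lerD le1 le2) _.
have neg (k : R) : k <= 0 -> trunc_inv_prim (k / q%:R) = k / q%:R / tau.
  move=> k0; rewrite /trunc_inv_prim ifT //.
  by rewrite (le_trans _ (ltW tau0)) // pmulr_lle0 ?invr_gt0.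
rewrite (neg (- 2 - 1)) ?(neg (- 1 - 1)); [|lra..].
have bnd (x : R) : x <= q%:R * 2^-1 ->
    q%:R * trunc_inv_prim (x / q%:R) <= q%:R * trunc_inv_prim 2^-1.
  by move=> hx; rewrite ler_wpM2l // le_trunc_inv_prim // ler_pdivrMr // mulrC.
have half : (q./2)%:R <= q%:R * 2^-1 :> R.
  rewrite ler_pdivlMr // -natrM ler_nat; lia.
have half' : (q - q./2)%:R <= q%:R * 2^-1 + 1 :> R.
  have : ((q - q./2) * 2)%:R <= (q + 2)%:R :> R by rewrite ler_nat; lia.
  by rewrite natrD natrM; lra.
have le3 := bnd ((q - q./2)%:R - 2 - 1) ltac:(lra).
have le4 := bnd ((q./2)%:R - 1 - 1) ltac:(lra).
have eqk (k : R) : q%:R * (k / q%:R / tau) = k / tau.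
  by field; rewrite !gt_eqF.
rewrite !mulrBr !eqk; lra.
Qed.

(** Here the integrals start at 2/q and 3/q and end at or beyond 1/2; the missing stretches next to
    0 cost at most 2/tau + 3/tau. *)
Lemma sum_trunc_inv_ge (q : nat) : (0 < q)%N ->
  2 * q%:R * trunc_inv_prim 2^-1 - 5 / tau <=
  \sum_(j < q) trunc_inv (((minn j (q - j))%:R + 2) / q%:R).
Proof.
move=> q0; have q0R : 0 < q%:R :> R by rewrite ltr0n.
rewrite (sum_minn_split _ (fun k => trunc_inv ((k%:R + 2) / q%:R))).
have /andP[le1 _] := sum_trunc_inv_shift (q - q./2) (- 2) q0.
have /andP[le2 _] := sum_trunc_inv_shift q./2 (- 3) q0.
under [X in _ <= X + _]eq_bigr do rewrite -{1}[2]opprK.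
under [X in _ <= _ + X]eq_bigr => k _.
  have -> : k.+1%:R + 2 = k%:R - - 3 :> R by rewrite -natr1; ring.
  over.
apply: le_trans (lerD le1 le2).
have bnd (x : R) : q%:R * 2^-1 <= x ->
    q%:R * trunc_inv_prim 2^-1 <= q%:R * trunc_inv_prim (x / q%:R).
  by move=> hx; rewrite ler_wpM2l // le_trunc_inv_prim // ler_pdivlMr // mulrC.
have half : q%:R * 2^-1 <= (q./2)%:R + 2^-1 :> R.
  have : q%:R <= (q./2 * 2 + 1)%:R :> R by rewrite ler_nat; lia.
  by rewrite natrD natrM; lra.
have half' : q%:R * 2^-1 <= (q - q./2)%:R :> R.
  by rewrite ler_pdivrMr // -natrM ler_nat; lia.
have le3 := bnd ((q - q./2)%:R - - 2) ltac:(lra).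
have le4 := bnd ((q./2)%:R - - 3) ltac:(lra).
have small (k : R) : 0 <= k -> q%:R * trunc_inv_prim (k / q%:R) <= k / tau.
  move=> k0; have -> : k / tau = q%:R * (k / q%:R / tau).
    by field; rewrite !gt_eqF.
  by rewrite ler_wpM2l // trunc_inv_prim_le // divr_ge0.
have le5 := small (- - 2) ltac:(lra); have le6 := small (- - 3) ltac:(lra).
rewrite !mulrBr; lra.
Qed.

End TruncatedInverse.

(** * Equidistribution of i alpha + beta over blocks of denominator length *)

Section Equidistribution.
Variable R : realType.
Implicit Types (alpha beta tau : R) (p : int).

(** In a difference of two values a cancels, and p is invertible mod q, so distinct indices below q
    leave distinct residues. *)
Lemma mulmodz_bij p (a : int) (q : nat) : (0 < q)%N -> coprimez p q ->
  exists s : 'I_q -> 'I_q, injective s /\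
    forall i : 'I_q, exists m : int, (i : nat)%:Z * p + a = m * q%:Z + (s i : nat)%:Z.
Proof.
move=> q0 cpq; have qn0 : q%:Z != 0 by rewrite eqz_nat -lt0n.
pose r (i : 'I_q) := (((i : nat)%:Z * p + a) %% q%:Z)%Z.
have r0 i : 0 <= r i by rewrite modz_ge0.
have r_lt i : (`|r i| < q)%N by rewrite -ltz_nat gez0_abs // ltz_pmod // ltz_nat.
exists (fun i => Ordinal (r_lt i)); split => [i j [/(congr1 Posz)]|i].
  rewrite !gez0_abs // => /eqP; rewrite eqz_mod_dvd.
  rewrite opprD addrACA subrr addr0 -mulrBl Gauss_dvdzl 1?coprimez_sym //.
  rewrite -eqz_mod_dvd !modz_small ?ltz_nat ?ltn_ord // eqz_nat => /eqP.
  exact: val_inj.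
exists (((i : nat)%:Z * p + a) %/ q%:Z)%Z.
by rewrite /= gez0_abs // -divz_eq.
Qed.

(** With a the floor of q beta, (i p + a)/q is a multiple of 1/q. It differs from i alpha + beta by
    i (q alpha - p)/q plus the fractional part of q beta over q, each at most 1/q. *)
Lemma nint_dist_residue alpha beta p (q : nat) :
  (0 < q)%N -> coprimez p q -> `|q%:R * alpha - p%:~R| <= q%:R^-1 ->
  exists s : 'I_q -> 'I_q, injective s /\ forall i : 'I_q,
    ((minn (s i) (q - s i))%:R - 2) / q%:R <= nint_dist (i%:R * alpha + beta)
      <= ((minn (s i) (q - s i))%:R + 2) / q%:R.
Proof.
move=> q0 cpq approx; have q0R : 0 < q%:R :> R by rewrite ltr0n.
have [s [inj_s sE]] := mulmodz_bij (Num.floor (q%:R * beta)) q0 cpq.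
exists s; split=> // i; have [m mE] := sE i.
rewrite mulrBl (mulrDl _ 2) -nint_dist_frac ?(ltnW (ltn_ord _)) //.
have dist : `|i%:R * alpha + beta - (s i)%:R / q%:R - m%:~R| <= 2 / q%:R.
  have /(congr1 (fun z : int => z%:~R : R)) := mE.
  rewrite !intrD !intrM -!pmulrn => mER.
  have /andP[] := floor_itv (q%:R * beta); rewrite intrD => lo hi.
  have -> : i%:R * alpha + beta - (s i)%:R / q%:R - m%:~R =
      (i%:R * (q%:R * alpha - p%:~R)
       + (q%:R * beta - (Num.floor (q%:R * beta))%:~R)) / q%:R.
    have -> : (s i)%:R = i%:R * p%:~R + (Num.floor (q%:R * beta))%:~R
                         - m%:~R * q%:R :> R by rewrite mER; ring.
    by field; rewrite gt_eqF.
  rewrite normrM [X in _ * X]gtr0_norm ?invr_gt0 // ler_wpM2r ?invr_ge0 //.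
  have le1 : `|i%:R * (q%:R * alpha - p%:~R)| <= 1.
    rewrite normrM normr_nat; apply: le_trans (ler_wpM2l (ler0n R i) approx) _.
    by rewrite ler_pdivrMr // mul1r ler_nat ltnW.
  apply: le_trans (ler_normD _ _) _.
  by rewrite [X in _ + X]ger0_norm; lra.
have := nint_dist_lipschitz (i%:R * alpha + beta) ((s i)%:R / q%:R) m.
have := nint_dist_lipschitz ((s i)%:R / q%:R) (i%:R * alpha + beta) (- m).
have -> : `|(s i)%:R / q%:R - (i%:R * alpha + beta) - (- m)%:~R| =
    `|i%:R * alpha + beta - (s i)%:R / q%:R - m%:~R|.
  by rewrite -normrN intrN; congr Num.norm; ring.
by move=> le1 le2; apply/andP; split; lra.
Qed.

Lemma sum_trunc_inv_block tau alpha beta p (q : nat) : 0 < tau ->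
  (0 < q)%N -> coprimez p q -> `|q%:R * alpha - p%:~R| <= q%:R^-1 ->
  `|\sum_(i < q) trunc_inv tau (nint_dist (i%:R * alpha + beta))
    - 2 * q%:R * trunc_inv_prim tau 2^-1| <= 5 / tau.
Proof.
move=> tau0 q0 cpq approx.
have [s [inj_s sE]] := nint_dist_residue beta q0 cpq approx.
have le1 := sum_trunc_inv_le tau0 q0; have le2 := sum_trunc_inv_ge tau0 q0.
rewrite (reindex_inj inj_s) /= in le1; rewrite (reindex_inj inj_s) /= in le2.
rewrite ler_distl; apply/andP; split.
  apply: le_trans le2 _; apply: ler_sum => i _; apply: le_trunc_inv => //.
  by case/andP: (sE i).
apply: le_trans le1; apply: ler_sum => i _; apply: le_trunc_inv => //.
by case/andP: (sE i).
Qed.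

(** The lower bound on q follows from c/q <= ||q alpha|| <= 1/Q. *)
Lemma dirichlet_badly_approximable alpha (c : R) (Q : nat) : (0 < Q)%N ->
  (forall n : nat, (0 < n)%N -> c <= n%:R * nint_dist (n%:R * alpha)) ->
  exists (q : nat) p, [/\ (0 < q <= Q)%N, c * Q%:R <= q%:R, coprimez p q &
    `|q%:R * alpha - p%:~R| <= q%:R^-1].
Proof.
move=> Q0 bad; have [q [p [/andP[q0 qQ] cpq approx]]] :=
  dirichlet_approximation alpha Q0.
have Q0R : 0 < Q%:R :> R by rewrite ltr0n.
exists q, p; split; rewrite ?q0 //.
  rewrite -ler_pdivlMr //; apply: le_trans (bad q q0) _.
  by rewrite ler_wpM2l // (le_trans (nint_dist_le _ p)).
by apply: le_trans approx _; rewrite lef_pV2 ?posrE ?ltr0n // ler_nat.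
Qed.

(* Blocks whose lengths are denominators are peeled off greedily: each removes
   a proportion at least c of the remaining range, so O(log N) of them are
   needed, and each costs 5 / tau. *)
Lemma sum_trunc_inv_nint_dist tau alpha (c : R) : 0 < tau -> 0 < c ->
  (forall n : nat, (0 < n)%N -> c <= n%:R * nint_dist (n%:R * alpha)) ->
  forall (N : nat) beta, (0 < N)%N ->
  `|\sum_(i < N) trunc_inv tau (nint_dist (i%:R * alpha + beta))
    - 2 * N%:R * trunc_inv_prim tau 2^-1| <= 5 / tau * (1 + ln N%:R / c).
Proof.
move=> tau0 c0 bad; elim/ltn_ind => N IH beta N0.
have [q [p [/andP[q0 qN] cq cpq approx]]] := dirichlet_badly_approximable N0 bad.
have block := sum_trunc_inv_block beta tau0 q0 cpq approx.
have lnN : 0 <= ln N%:R :> R by rewrite ln_ge0 // ler1n.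
have t5 : 0 < 5 / tau by rewrite divr_gt0.
case: (ltngtP q N) qN => // [ltqN _|eqN _]; last first.
  rewrite -eqN; apply: le_trans block _.
  by rewrite ler_peMr ?(ltW t5) // lerDl divr_ge0 ?(ltW c0) // eqN.
pose M := (N - q)%N; have M0 : (0 < M)%N by rewrite subn_gt0.
have NE : N = (q + M)%N by rewrite subnKC // ltnW.
(* Dropping the first q points turns beta into q alpha + beta, so the induction ranges over every
   beta. *)
have := IH M ltac:(by rewrite NE; lia) (q%:R * alpha + beta) M0.
set rest := \sum_(i < M) _ => restP.
have -> : \sum_(i < N) trunc_inv tau (nint_dist (i%:R * alpha + beta)) =
    \sum_(i < q) trunc_inv tau (nint_dist (i%:R * alpha + beta)) + rest.
  rewrite NE big_split_ord /=; congr (_ + _); apply: eq_bigr => i _.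
  by rewrite natrD mulrDl addrA [X in X + beta]addrC.
have NR : N%:R = q%:R + M%:R :> R by rewrite -natrD -NE.
have N0R : 0 < N%:R :> R by rewrite ltr0n.
have M0R : 0 < M%:R :> R by rewrite ltr0n.
(* As M/N <= 1 - c, ln (M/N) <= -c: the budget ln N / c drops by at least 1, which pays for the
   removed block. *)
have lnM_le : ln M%:R / c <= ln N%:R / c - 1.
  have -> : ln N%:R / c - 1 = (ln N%:R - c) / c by field; rewrite gt_eqF.
  rewrite ler_pM2r ?invr_gt0 // lerBrDr.
  have : ln (M%:R / N%:R : R) <= M%:R / N%:R - 1 by apply: ln_le_subr1; rewrite divr_gt0.
  have : M%:R / N%:R <= 1 - c by rewrite ler_pdivrMr // mulrBl; lra.
  by rewrite ln_div ?posrE //; lra.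
apply: (le_trans _ (_ : 5 / tau + 5 / tau * (1 + ln M%:R / c) <= _)); last by nra.
apply: le_trans (lerD block restP); rewrite NR.
by apply: le_trans (ler_normD _ _); rewrite le_eqVlt; apply/orP; left;
  apply/eqP; congr Num.norm; ring.
Qed.

End Equidistribution.

(** * The truncated logarithm *)

Section TruncatedLog.
Variable R : realType.
Implicit Types x y : R.

Lemma tlog_ge1 x : 1 <= tlog x.
Proof.
rewrite -[leLHS](expRK 1) ler_ln ?posrE ?lt_max ?expR_gt0 //.
by rewrite le_max lexx.
Qed.

Lemma le_tlog x y : x <= y -> tlog x <= tlog y.
Proof.
move=> xy; rewrite ler_ln ?posrE ?lt_max ?expR_gt0 //.
by rewrite ge_max !le_max lexx xy orbT.
Qed.

Lemma ln_le_tlog x : 0 < x -> ln x <= tlog x.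
Proof.
by move=> x0; rewrite ler_ln ?posrE ?lt_max ?x0 ?orbT // le_max lexx orbT.
Qed.

(** Keeps the cut-off [tlog N / N] at most 1/2, so that [trunc_inv_prim] at 1/2 is in its
    logarithmic range. Below e the left side is 1; beyond, ln x <= x/e and e >= 2. *)
Lemma tlog_le_half x : 2 <= x -> tlog x <= x / 2.
Proof.
move=> x2; rewrite /tlog; have e2 := expR_ge1Dx (1 : R).
have e0 := expR_gt0 (1 : R); have x0 : 0 < x by lra.
have [ex|xe] := lerP (expR 1) x; last by rewrite expRK; lra.
have := ln_le_subr1 (divr_gt0 x0 e0); rewrite ln_div ?posrE // expRK => le1.
have : x / expR 1 <= x / 2.
  by rewrite ler_pM2l // lef_pV2 ?posrE //; lra.
lra.
Qed.

End TruncatedLog.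

(** * The sum without its largest term *)

Section MinimumExcluded.
Variable R : realType.
Implicit Types alpha beta : R.

(** The two distances add up to at least ||(n - n0) alpha|| >= c/N, and the larger one is at least
    half of that. *)
Lemma nint_dist_sep alpha beta (c : R) (N n0 n : nat) :
  (forall n : nat, (0 < n)%N -> c <= n%:R * nint_dist (n%:R * alpha)) ->
  (1 <= n0 <= N)%N -> (1 <= n <= N)%N -> n != n0 ->
  nint_dist (n0%:R * alpha + beta) <= nint_dist (n%:R * alpha + beta) ->
  c / (2 * N%:R) <= nint_dist (n%:R * alpha + beta).
Proof.
move=> bad n0N nN neq le_n0.
have N0 : 0 < N%:R :> R by rewrite ltr0n; lia.
have sep : forall i j : nat, (i < j <= N)%N ->
    c / N%:R <= nint_dist (j%:R * alpha + beta) + nint_dist (i%:R * alpha + beta).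
  move=> i j /andP[ij jN]; rewrite ler_pdivrMr //.
  apply: le_trans (bad (j - i)%N _) _; first by rewrite subn_gt0.
  rewrite mulrC ler_pM ?nint_dist_ge0 //; last first.
    by rewrite ler_nat (leq_trans (leq_subr _ _)).
  have -> : (j - i)%:R * alpha = (j%:R * alpha + beta) - (i%:R * alpha + beta).
    by rewrite natrB 1?ltnW //; ring.
  by apply: le_trans (nint_distD _ _) _; rewrite nint_distN.
have -> : c / (2 * N%:R) = c / N%:R / 2 by field; rewrite gt_eqF.
move: n0N nN => /andP[_ n0N] /andP[_ nN].
have [lt1|lt1|eq1] := ltngtP n n0; last by rewrite eq1 eqxx in neq.
  by have := sep n n0 ltac:(by rewrite lt1); lra.
by have := sep n0 n ltac:(by rewrite lt1); lra.
Qed.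

Lemma sum_inv_nint_dist_offmin alpha : badly_approximable alpha ->
  exists C : R, 0 <= C /\ forall (beta : R) (N n0 : nat),
    (1 <= N)%N -> (1 <= n0 <= N)%N ->
    (forall n : nat, (1 <= n <= N)%N ->
      nint_dist (n0%:R * alpha + beta) <= nint_dist (n%:R * alpha + beta)) ->
    `| \sum_(1 <= n < N.+1 | n != n0) 1 / nint_dist (n%:R * alpha + beta)
       - 2 * N%:R * ln N%:R |
    <= C * (N%:R * tlog (tlog N%:R)).
Proof.
case/badly_approximableP => c [c0 c1 bad].
(* For a block length q <= 2 N / c: 4/c comes from 2 q, and 2 + 1/c from ln L + ln 2 - ln c; 10/c
   and 5 come from the errors 5/tau' and 5/tau. *)
pose D : R := 4 / c * (2 + c^-1) + 10 / c + 5.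
have ci0 : 0 < c^-1 by rewrite invr_gt0.
have D0 : 0 <= D by rewrite /D; nra.
(* D pays for the gaps, 5 + 5/c for the block errors, 4 for 2 N (1 - ln 2 - ln L) and 1 for the
   truncated term at n0. *)
exists (D + (5 + 5 / c) + 4 + 1); split; first by nra.
move=> beta N n0; case: N => [//|[|N]] N1 n0N min_n0.
  (* For N = 1 the sum is empty; the cut-off [tlog N / N] is at most 1/2 only from N = 2 on. *)
  have -> : n0 = 1%N by lia.
  rewrite big_mkcond big_nat1 eqxx /= ln1 mulr0 subrr normr0 mulr_ge0 //.
    by nra.
  by rewrite mul1r (le_trans ler01) // tlog_ge1.
move: N.+2 (isT : (2 <= N.+2)%N) N1 n0N min_n0 => {}N N2 N1 n0N min_n0.
have N2R : 2 <= N%:R :> R by rewrite ler_nat.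
have N0R : 0 < N%:R :> R by lra.
set L := tlog N%:R; set LL := tlog L.
have L1 : 1 <= L := tlog_ge1 _; have LL1 : 1 <= LL := tlog_ge1 _.
have LN : L <= N%:R / 2 := tlog_le_half N2R.
have lnL0 : 0 <= ln L by rewrite ln_ge0.
have lnL : ln L <= LL by apply: ln_le_tlog; lra.
have lnN : ln N%:R <= L by apply: ln_le_tlog.
(* With tau the O(log N) block errors of size 1/tau add up to O(N); tau' is the lower bound for all
   distances but the smallest. *)
pose tau := L / N%:R; pose tau' := c / (2 * N%:R).
have tau0 : 0 < tau by rewrite divr_gt0 //; lra.
have tau'0 : 0 < tau' by rewrite divr_gt0 //; lra.
have tau'E : tau' = c / 2 / N%:R by rewrite /tau'; field; rewrite gt_eqF.
have le_tau : tau' <= tau by rewrite tau'E ler_pM2r ?invr_gt0 //; lra.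
have tau_half : tau <= 2^-1 by rewrite ler_pdivrMr // mulrC.
have inv_tau : tau^-1 <= N%:R.
  by rewrite /tau invf_div ler_pdivrMr //; nra.
have inv_tau' : tau'^-1 = 2 / c * N%:R by rewrite /tau' invf_div; ring.
have ln2 : ln 2 <= 1 :> R by apply: le_trans (ln_le_subr1 _) _; lra.
have ln20 : 0 <= ln 2 :> R by rewrite ln_ge0 //; lra.
have lnhalf : ln 2^-1 = - ln 2 :> R by rewrite lnV ?posrE.
have lntau : ln tau = ln L - ln N%:R by rewrite ln_div ?posrE //; lra.
have lntau' : ln tau' = ln c - ln 2 - ln N%:R.
  by rewrite tau'E !ln_div ?posrE // divr_gt0.
pose d n := nint_dist (n%:R * alpha + beta).
(* The range starts at n = 1, so indexing from 0 turns beta into alpha + beta. *)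
have sumE (f : R -> R) :
    \sum_(1 <= n < N.+1) f (d n) =
    \sum_(i < N) f (nint_dist (i%:R * alpha + (alpha + beta))).
  rewrite big_add1 /= big_mkord; apply: eq_bigr => i _.
  by rewrite /d -natr1 mulrDl mul1r addrA.
(* Away from n0 the truncation at tau' is invisible.  Raising the cut-off to tau
   changes the sum by a sum of gaps, which may be extended from [1, N] to a full
   block of length O(N); there the factor log N = - ln tau' + O(1) cancels and
   ln (tau / tau') = O(LL) remains. *)
pose gap x := trunc_inv tau' x - trunc_inv tau x.
have gap0 x : 0 <= gap x.
  rewrite subr_ge0 lef_pV2 ?posrE ?lt_max ?tau0 ?tau'0 //.
  by rewrite ge_max !le_max le_tau lexx orbT.
have -> : \sum_(1 <= n < N.+1 | n != n0) 1 / nint_dist (n%:R * alpha + beta) =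
    \sum_(1 <= n < N.+1 | n != n0) trunc_inv tau (d n) +
    \sum_(1 <= n < N.+1 | n != n0) gap (d n).
  rewrite -big_split /= big_nat_cond [RHS]big_nat_cond; apply: eq_bigr.
  move=> n /andP[nN neq]; rewrite subrKC trunc_invE ?mul1r //.
  exact: nint_dist_sep bad n0N nN neq (min_n0 n nN).
have gap_le : \sum_(1 <= n < N.+1 | n != n0) gap (d n) <= D * (N%:R * LL).
  (* Q just above N/c makes the denominator q satisfy N <= c Q <= q <= Q <= 2 N / c, so one block
     covers the whole range. *)
  have [Q [Q0 Q1 Q2]] : exists Q : nat,
      [/\ (0 < Q)%N, N%:R <= c * Q%:R & Q%:R <= 2 / c * N%:R].
    have Nc : 0 <= N%:R / c by rewrite divr_ge0 // ltW.
    have := truncn_itv Nc => /andP[lo hi]; exists (Num.truncn (N%:R / c)).+1.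
    split=> //; first by rewrite mulrC -ler_pdivrMr // ltW.
    have : 1 <= N%:R / c by rewrite ler_pdivlMr //; lra.
    by rewrite -natr1; lra.
  have [q [p [/andP[q0 qQ] cq cpq approx]]] := dirichlet_badly_approximable Q0 bad.
  have Nq : (N <= q)%N by rewrite -(ler_nat R); lra.
  have qQR : q%:R <= Q%:R :> R by rewrite ler_nat.
  apply: (@le_trans _ _ (\sum_(1 <= n < N.+1) gap (d n))).
    rewrite big_mkcond /= ler_sum // => n _; case: ifP => // _; exact: gap0.
  rewrite sumE.
  apply: (@le_trans _ _
      (\sum_(i < q) gap (nint_dist (i%:R * alpha + (alpha + beta))))).
    rewrite (big_ord_widen q (fun i => gap (nint_dist (i%:R * alpha + _)))) //.
    rewrite big_mkcond /= ler_sum // => n _; case: ifP => // _; exact: gap0.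
  rewrite big_split /= sumrN.
  have := sum_trunc_inv_block (alpha + beta) tau'0 q0 cpq approx.
  have := sum_trunc_inv_block (alpha + beta) tau0 q0 cpq approx.
  rewrite !ler_distl => /andP[lo _] /andP[_ hi].
  rewrite trunc_inv_prim_large // in lo.
  rewrite trunc_inv_prim_large ?(le_trans le_tau) // in hi.
  rewrite lnhalf lntau in lo; rewrite lnhalf lntau' inv_tau' in hi.
  have lnc : - ln c <= c^-1 - 1.
    by rewrite -lnV ?posrE // ln_le_subr1.
  apply: (@le_trans _ _ (2 * q%:R * (ln L + ln 2 - ln c)
                         + 10 / c * N%:R + 5 * N%:R)).
    move: lo hi inv_tau; set X := \sum_(i < q) _; set Y := \sum_(i < q) _.
    lra.
  have : 2 * q%:R * (ln L + ln 2 - ln c) <= 4 / c * N%:R * (LL + LL + c^-1 * LL).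
    have lnc0 : ln c <= 0 by rewrite ln_le0 //; lra.
    by rewrite ler_pM //; [lra|lra|nra].
  have NLL : N%:R <= N%:R * LL by nra.
  have : 10 / c * N%:R <= 10 / c * (N%:R * LL) by rewrite ler_pM2l //; lra.
  by rewrite /D; lra.
have gap_ge : 0 <= \sum_(1 <= n < N.+1 | n != n0) gap (d n).
  by apply: sumr_ge0 => n _; exact: gap0.
have n0_mem : n0 \in index_iota 1 N.+1 by rewrite mem_index_iota.
(* The full truncated sum also contains the term at n0, which is at most 1/tau <= N. *)
have := sum_trunc_inv_nint_dist tau0 c0 bad (alpha + beta) N1.
rewrite -(sumE (trunc_inv tau)) (bigD1_seq n0) ?iota_uniq //=.
have := trunc_inv_le tau0 (d n0); have := trunc_inv_gt0 tau0 (d n0).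
rewrite trunc_inv_prim_large // lnhalf lntau.
set S := \sum_(_ <= _ < _ | _) trunc_inv _ _.
set G := \sum_(_ <= _ < _ | _) gap _ in gap_le gap_ge *.
set t := trunc_inv _ _ => t0 t1 main.
have err : 5 / tau * (1 + ln N%:R / c) <= (5 + 5 / c) * N%:R.
  rewrite /tau invf_div.
  have -> : 5 * (N%:R / L) * (1 + ln N%:R / c) =
     N%:R * (5 / L + 5 * (ln N%:R / L) / c) by ring.
  have : L^-1 <= 1 by rewrite invf_le1 //; lra.
  have : ln N%:R / L <= 1 by rewrite ler_pdivrMr ?mul1r //; lra.
  move=> h1 h2; rewrite [leRHS]mulrC ler_pM2l // lerD //; first lra.
  by rewrite ler_pM2r // ; lra.
have NLL : N%:R <= N%:R * LL by rewrite ler_peMr // ltW.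
have NlnL : N%:R * ln L <= N%:R * LL by rewrite ler_wpM2l // ltW.
have NlnL0 : 0 <= N%:R * ln L by rewrite mulr_ge0 // ltW.
have Nln20 : 0 <= N%:R * ln 2 :> R by rewrite mulr_ge0 // ltW.
have Nln2 : N%:R * ln 2 <= N%:R :> R by rewrite ler_piMr // ltW.
move: main; rewrite !ler_distl => /andP[lo hi].
have c5 : (5 + 5 / c) * N%:R <= (5 + 5 / c) * (N%:R * LL).
  by rewrite ler_wpM2l //; lra.
have DN : 0 <= D * (N%:R * LL) by rewrite mulr_ge0 //; lra.
by apply/andP; split; lra.
Qed.

End MinimumExcluded.

(** * The sum over all n *)

Section SumsWithMinimum.
Variable R : realType.
Implicit Types alpha beta : R.

Lemma inf_tlog_lower_bound alpha beta :
  0 < inf [set n%:R * tlog (tlog n%:R) * nint_dist (n%:R * alpha + beta)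
          | n in [set n : nat | (0 < n)%N]] ->
  exists d : R, 0 < d /\ forall n : nat, (0 < n)%N ->
    0 < nint_dist (n%:R * alpha + beta) /\
    1 / nint_dist (n%:R * alpha + beta) <= d * (n%:R * tlog (tlog n%:R)).
Proof.
set d := inf _ => d0; exists d^-1; split=> [|n n0]; first by rewrite invr_gt0.
have tl0 : 0 < tlog (tlog n%:R) :> R := lt_le_trans ltr01 (tlog_ge1 _).
have n0R : 0 < n%:R :> R by rewrite ltr0n.
have le_d : d <= n%:R * tlog (tlog n%:R) * nint_dist (n%:R * alpha + beta).
  apply: ge_inf; last by exists n.
  exists 0 => _ [k _ <-]; rewrite !mulr_ge0 ?nint_dist_ge0 //.
  exact: le_trans ler01 (tlog_ge1 _).
have x0 : 0 < nint_dist (n%:R * alpha + beta).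
  by rewrite -(pmulr_rgt0 _ (mulr_gt0 n0R tl0)) (lt_le_trans d0).
by split=> //; rewrite ler_pdivrMr // -mulrA ler_pdivlMl // mulr1.
Qed.

(** Restores the term at a minimiser n <= N, which the hypothesis on beta bounds by d n log log n <=
    d N log log N. *)
Lemma sum_inv_nint_dist alpha beta : badly_approximable alpha ->
  0 < inf [set n%:R * tlog (tlog n%:R) * nint_dist (n%:R * alpha + beta)
          | n in [set n : nat | (0 < n)%N]] ->
  exists C : R, 0 <= C /\ forall N : nat, (1 <= N)%N ->
    `| \sum_(1 <= n < N.+1) 1 / nint_dist (n%:R * alpha + beta)
       - 2 * N%:R * ln N%:R |
    <= C * (N%:R * tlog (tlog N%:R)).
Proof.
move=> /sum_inv_nint_dist_offmin[C [C0 main]] /inf_tlog_lower_bound[d [d0 bd]].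
exists (C + d); split=> [|N N1]; first by rewrite addr_ge0 // ltW.
case: N N1 => // N _.
pose m := [arg min_(i < (ord0 : 'I_N.+1)) nint_dist (i.+1%:R * alpha + beta)]%O.
have m_min (n : nat) : (1 <= n <= N.+1)%N ->
    nint_dist (m.+1%:R * alpha + beta) <= nint_dist (n%:R * alpha + beta).
  rewrite /m; case: arg_minP => // i _ le_i.
  by case: n => // n nN; exact: (le_i (Ordinal nN)).
have mN : (1 <= m.+1 <= N.+1)%N by rewrite /= ltn_ord.
have := main beta N.+1 m.+1 isT mN m_min.
have [_ bm] := bd m.+1 isT.
rewrite [X in _ -> `|X - _| <= _](bigD1_seq m.+1) ?iota_uniq ?mem_index_iota //=.
set S := \sum_(_ <= _ < _ | _) _ => bS.
have x0 : 0 <= 1 / nint_dist (m.+1%:R * alpha + beta).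
  by rewrite divr_ge0 // nint_dist_ge0.
rewrite -addrA (mulrDl C) [X in `|X|]addrC; apply: le_trans (ler_normD _ _) (lerD bS _).
rewrite ger0_norm //; apply: le_trans bm _; rewrite ler_pM2l //.
rewrite ler_pM ?ler_nat ?ltn_ord // ?(le_trans ler01 (tlog_ge1 _)) //.
by rewrite !le_tlog // ler_nat ltn_ord.
Qed.

(** * Logarithmic sums and Abel summation *)

Lemma ln_succ_bounds (n : nat) : (0 < n)%N ->
  (n.+1%:R : R)^-1 <= ln n.+1%:R - ln n%:R <= (n%:R : R)^-1.
Proof.
move=> n0; have n0R : 0 < n%:R :> R by rewrite ltr0n.
have n1R : 0 < n.+1%:R :> R by rewrite ltr0n.
have := ln_le_subr1 (divr_gt0 n1R n0R); have := ln_le_subr1 (divr_gt0 n0R n1R).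
rewrite !ln_div ?posrE //.
have -> : n.+1%:R / n%:R - 1 = n%:R^-1 :> R.
  by rewrite -natr1; field; rewrite gt_eqF.
have -> : n%:R / n.+1%:R - 1 = - n.+1%:R^-1 :> R.
  by rewrite -natr1 in n1R *; field; rewrite gt_eqF.
by move=> h1 h2; rewrite h2 andbT -lerN2 opprB.
Qed.

Lemma harmonic_le (N : nat) :
  \sum_(1 <= n < N.+1) (n.+1%:R : R)^-1 <= ln N.+1%:R.
Proof.
have -> : ln N.+1%:R = ln N.+1%:R - ln 1%:R :> R by rewrite ln1 subr0.
rewrite -(telescope_sumr (fun n => ln n%:R : R)) //.
rewrite big_nat_cond [leRHS]big_nat_cond ler_sum // => n.
by rewrite andbT => /andP[n0 _]; case/andP: (ln_succ_bounds n0).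
Qed.

(** The increment of (ln n)^2 exceeds the summand by at most (2 ln N + 2)/(n (n + 1)), and 1/(n (n +
    1)) is the increment of -1/n, so both bounds telescope. *)
Lemma sum_ln_div_bounds (N : nat) : (0 < N)%N ->
  `|\sum_(1 <= n < N.+1) 2 * ln n%:R / n.+1%:R - (ln N%:R) ^+ 2|
    <= 4 * ln N%:R + 3 :> R.
Proof.
move=> N0; have lnN0 : 0 <= ln N%:R :> R by rewrite ln_ge0 // ler1n.
pose v n : R := (ln n%:R) ^+ 2; pose w n : R := - n%:R^-1.
have step n : (1 <= n < N.+1)%N ->
    v n.+1 - v n - (2 * ln N%:R + 2) * (w n.+1 - w n)
      <= 2 * ln n%:R / n.+1%:R <= v n.+1 - v n.
  move=> /andP[n0 nN]; have n1 : 1 <= n%:R :> R by rewrite ler1n.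
  have n0R : 0 < n%:R :> R by lra.
  have a0 : 0 <= ln n%:R :> R by rewrite ln_ge0.
  have aN : ln n%:R <= ln N%:R :> R.
    by rewrite ler_ln ?posrE ?ltr0n // ler_nat.
  have /andP[lo hi] := ln_succ_bounds n0.
  rewrite /v /w; set a : R := ln n%:R in a0 aN lo hi *.
  set b : R := ln n.+1%:R in lo hi *.
  set x : R := n%:R^-1 in hi *; set y : R := n.+1%:R^-1 in lo *.
  have xy : x - y = x * y.
    by rewrite /x /y -natr1; field; rewrite !gt_eqF //; lra.
  have y0 : 0 < y by rewrite invr_gt0 ltr0n.
  have xy2 : x <= 2 * y.
    rewrite /x /y ler_pdivlMr ?ltr0n // mulrC ler_pdivrMr // -natr1; lra.
  have x1 : 0 < x by rewrite invr_gt0.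
  apply/andP; split; last by nra.
  have -> : - y - - x = x * y by rewrite -xy; ring.
  have sq : b ^+ 2 - a ^+ 2 = (b - a) * (2 * a + (b - a)) by ring.
  have : (b - a) * (2 * a + (b - a)) <= x * (2 * a + x).
    by rewrite ler_pM //; lra.
  have : x * x <= 2 * (x * y) by nra.
  have : x * y * a <= x * y * ln N%:R by rewrite ler_wpM2l // mulr_ge0 // ltW.
  have : 2 * (x * a) = 2 * (y * a) + 2 * (x * y * a) by rewrite -xy; ring.
  by rewrite sq; lra.
have tele (u : nat -> R) :
    \sum_(1 <= n < N.+1) (u n.+1 - u n) = u N.+1 - u 1%N.
  by rewrite telescope_sumr.
set A := \sum_(1 <= n < N.+1) _.
have up : A <= v N.+1 - v 1%N.
  rewrite -tele /A big_nat_cond [leRHS]big_nat_cond ler_sum // => n.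
  by rewrite andbT => /step/andP[].
have low : v N.+1 - v 1%N - (2 * ln N%:R + 2) * (w N.+1 - w 1%N) <= A.
  rewrite -!tele mulr_sumr -sumrB.
  rewrite /A big_nat_cond [leRHS]big_nat_cond ler_sum // => n.
  by rewrite andbT => /step/andP[].
have v1 : v 1%N = 0 by rewrite /v ln1 expr0n.
have w1 : w N.+1 - w 1%N <= 1.
  by rewrite /w invr1 opprK gerDr oppr_le0 invr_ge0.
have /andP[lo hi] := ln_succ_bounds N0.
have i1 : (N%:R : R)^-1 <= 1 by rewrite invf_le1 ?ltr0n // ler1n.
have ge_ln : 0 <= ln N.+1%:R - ln N%:R :> R.
  by apply: le_trans lo; rewrite invr_ge0.
have le_ln := le_trans hi i1.
have vN : v N <= v N.+1 <= v N + 2 * ln N%:R + 1.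
  by rewrite /v; move: ge_ln le_ln; set b := ln N.+1%:R => ge_ln le_ln;
    apply/andP; split; nra.
rewrite v1 in up low; rewrite -/(v N) ler_norml.
by apply/andP; split; nra.
Qed.

(** Partial sums get the weights 1/n - 1/(n + 1); the boundary term is over N + 1 because the last
    sum includes n = N. *)
Lemma abel_summation (a : nat -> R) (N : nat) :
  \sum_(1 <= n < N.+1) a n / n%:R =
  (\sum_(1 <= n < N.+1) a n) / N.+1%:R +
  \sum_(1 <= n < N.+1) (\sum_(1 <= k < n.+1) a k) / (n%:R * n.+1%:R).
Proof.
elim: N => [|N IH]; first by rewrite !big_nil mul0r addr0.
rewrite !(big_nat_recr N.+1) //= IH.
set S := \sum_(1 <= n < N.+1) a n.
set T := \sum_(1 <= n < N.+1) _ / _.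
by rewrite -!natr1; field; rewrite !gt_eqF // ?ltr0n // ?natr1 ?ltr0n.
Qed.

(** Abel summation turns 2 n ln n into 2 ln n / (n + 1), whose sum is (ln N)^2 up to 4 L + 3. The
    boundary term adds 2 L + C LL and the errors C LL (L + 1), in all at most (3 C + 9) L LL. *)
Lemma sum_inv_mul_nint_dist (a : nat -> R) (C : R) : 0 <= C ->
  (forall N : nat, (1 <= N)%N ->
    `|\sum_(1 <= n < N.+1) a n - 2 * N%:R * ln N%:R|
      <= C * (N%:R * tlog (tlog N%:R))) ->
  forall N : nat, (1 <= N)%N ->
    `|\sum_(1 <= n < N.+1) a n / n%:R - (ln N%:R) ^+ 2|
      <= (3 * C + 9) * (tlog N%:R * tlog (tlog N%:R)).
Proof.
move=> C0 bound N N1; rewrite abel_summation.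
set L := tlog N%:R; set LL := tlog L.
have L1 : 1 <= L := tlog_ge1 _; have LL1 : 1 <= LL := tlog_ge1 _.
have N0R : 0 < N%:R :> R by rewrite ltr0n.
have lnN0 : 0 <= ln N%:R :> R by rewrite ln_ge0 // ler1n.
have lnN : ln N%:R <= L by apply: ln_le_tlog.
have LLL : L <= L * LL by rewrite ler_peMr //; lra.
have main := sum_ln_div_bounds N1.
pose S n := \sum_(1 <= k < n.+1) a k.
rewrite -/(S N).
have last : `|S N / N.+1%:R| <= 2 * L + C * LL.
  rewrite normrM [X in _ * X]gtr0_norm ?invr_gt0 ?ltr0n //.
  rewrite ler_pdivrMr ?ltr0n //.
  have := bound N N1; rewrite -/(S N) => bS.
  have : `|S N| <= C * (N%:R * LL) + 2 * N%:R * ln N%:R.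
    have -> : S N = (S N - 2 * N%:R * ln N%:R) + 2 * N%:R * ln N%:R by ring.
    apply: le_trans (ler_normD _ _) _; apply: lerD => //.
    by rewrite ger0_norm // !mulr_ge0.
  have : N%:R * ln N%:R <= N%:R * L by rewrite ler_wpM2l.
  have : 0 <= C * LL by rewrite mulr_ge0 //; lra.
  by rewrite -(natr1 N); lra.
(* The iterated logarithm is largest at N and factors out, leaving the sum of 1/(n + 1), at most ln
   (N + 1) <= L + 1. *)
have error : `|\sum_(1 <= n < N.+1) S n / (n%:R * n.+1%:R)
    - \sum_(1 <= n < N.+1) 2 * ln n%:R / n.+1%:R| <= C * LL * (L + 1).
  have /andP[_ succ] := ln_succ_bounds N1.
  have i1 : (N%:R : R)^-1 <= 1 by rewrite invf_le1 // ler1n.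
  have := harmonic_le N; rewrite -sumrB => harm.
  apply: le_trans (ler_norm_sum _ _ _) _.
  apply: (@le_trans _ _ (\sum_(1 <= n < N.+1) C * LL * n.+1%:R^-1)).
    rewrite big_nat_cond [leRHS]big_nat_cond ler_sum // => n.
    rewrite andbT => /andP[n1 nN].
    have n0R : 0 < n%:R :> R by rewrite ltr0n.
    have -> : S n / (n%:R * n.+1%:R) - 2 * ln n%:R / n.+1%:R =
        (S n - 2 * n%:R * ln n%:R) / n%:R / n.+1%:R.
      by rewrite -natr1; field; rewrite natr1 !gt_eqF // ltr0n.
    rewrite normrM [X in _ * X]gtr0_norm ?invr_gt0 ?ltr0n //.
    rewrite ler_pM2r ?invr_gt0 ?ltr0n //.
    rewrite normrM [X in _ * X]gtr0_norm ?invr_gt0 // ler_pdivrMr //.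
    apply: le_trans (bound n n1) _; rewrite -mulrA ler_wpM2l // mulrC.
    by rewrite ler_wpM2r // !le_tlog // ler_nat.
  rewrite -mulr_sumr ler_wpM2l //; first by rewrite mulr_ge0 //; lra.
  lra.
have CLL : C * LL <= C * (L * LL).
  by rewrite ler_wpM2l // ler_peMl //; lra.
have one : 1 <= L * LL by apply: le_trans LLL.
set E := \sum_(1 <= n < N.+1) S n / _ in error *.
set A := \sum_(1 <= n < N.+1) 2 * _ / _ in error main *.
have -> : S N / N.+1%:R + E - ln N%:R ^+ 2 =
    S N / N.+1%:R + ((E - A) + (A - ln N%:R ^+ 2)) by ring.
apply: le_trans (ler_normD _ _) _.
apply: le_trans (lerD last (le_trans (ler_normD _ _) (lerD error main))) _.
lra.
Qed.

End SumsWithMinimum.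

Theorem theorem6 (R : realType) (alpha : R)
    (irr_alpha : irrational alpha) (bad_alpha : badly_approximable alpha) :
  (exists C : R, forall (beta : R) (N n0 : nat),
    (1 <= N)%N -> (1 <= n0 <= N)%N ->
    (forall n : nat, (1 <= n <= N)%N ->
      nint_dist (n0%:R * alpha + beta) <= nint_dist (n%:R * alpha + beta)) ->
    `| \sum_(1 <= n < N.+1 | n != n0) 1 / nint_dist (n%:R * alpha + beta)
       - 2 * N%:R * ln N%:R |
    <= C * (N%:R * tlog (tlog N%:R)))
  /\
  (forall beta : R,
    0 < inf [set n%:R * tlog (tlog n%:R) * nint_dist (n%:R * alpha + beta)
            | n in [set n : nat | (0 < n)%N]] ->
    (exists C : R, forall N : nat, (1 <= N)%N ->
      `| \sum_(1 <= n < N.+1) 1 / nint_dist (n%:R * alpha + beta)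
         - 2 * N%:R * ln N%:R |
      <= C * (N%:R * tlog (tlog N%:R)))
    /\
    (exists C : R, forall N : nat, (1 <= N)%N ->
      `| \sum_(1 <= n < N.+1) 1 / (n%:R * nint_dist (n%:R * alpha + beta))
         - (ln N%:R) ^+ 2 |
      <= C * (tlog N%:R * tlog (tlog N%:R)))).
Proof.
split.
  have [C [_ bound]] := sum_inv_nint_dist_offmin bad_alpha.
  by exists C => beta N n0; exact: bound.
move=> beta inf_gt0.
have [C [C0 bound]] := sum_inv_nint_dist bad_alpha inf_gt0.
split; first by exists C.
exists (3 * C + 9) => N N1.
under eq_bigr => n _ do rewrite invfM mulrCA mulrC.
exact: sum_inv_mul_nint_dist C0 bound N N1.
Qed.
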